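(* Let $\mathcal{X}\sim\mathcal{N}_{\mathrm{I}}(0,I_{d_1},\ldots,I_{d_m})$ be a random tensor of size $\mathrm{I}=d_1\times d_2\times\cdots\times d_m$ following a standard normal distribution. Then the characteristic function of $\mathcal{X}$ is $$\phi_{\mathcal{X}}(\mathcal{T})=\exp\left(-\tfrac12\langle\mathcal{T},\mathcal{T}\rangle\right),\qquad \mathcal{T}=(T_{i_1\ldots i_m})\in\mathbb{R}^{d_1\times d_2\times\cdots\times d_m}.$$
   Context: A random $m$-order tensor $\mathcal{X}\in\mathbb{R}^{d_1\times\cdots\times d_m}$ (entries are real random variables on a common probability space) follows a standard normal distribution, $\mathcal{X}\sim\mathcal{N}_{\mathrm{I}}(0,I_{d_1},\ldots,I_{d_m})$, if for each mode $k\in\{1,\ldots,m\}$ the mode-$k$ fibres of $\mathcal{X}$ (the vectors in $\mathbb{R}^{d_k}$ obtained by fixing all indices but the $k$-th) are i.i.d. $\mathcal{N}_{d_k}(0,I_{d_k})$; its density is $f_{\mathcal{X}}(\mathcal{T})=(2\pi)^{-d/2}\exp(-\frac12\langle\mathcal{T},\mathcal{T}\rangle)$ with $d=d_1d_2\cdots d_m$. The inner product is $\langle\mathcal{S},\mathcal{T}\rangle=\sum_{i_1,\ldots,i_m}S_{i_1\ldots i_m}T_{i_1\ldots i_m}$, and the characteristic function of $\mathcal{X}$ is $\phi_{\mathcal{X}}(\mathcal{T})=E[\exp(\imath\langle\mathcal{T},\mathcal{X}\rangle)]$, with $\imath$ the imaginary unit. *)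

(* Defs.v *)
From HB Require Import structures.
From mathcomp Require Import all_boot all_order all_algebra.
From mathcomp Require Import all_classical all_reals all_analysis.
From mathcomp Require Import complex.

Set Implicit Arguments.
Unset Strict Implicit.
Unset Printing Implicit Defensive.

Import Order.TTheory GRing.Theory Num.Theory.
Import numFieldNormedType.Exports.

Local Open Scope classical_set_scope.
Local Open Scope ring_scope.

Section Tensors.
Context (R : realType) (m : nat) (d : 'I_m -> nat).

(* Multi-indices (i_1, ..., i_m), with modes numbered from 0. *)
Definition mindex := {dffun forall k : 'I_m, 'I_(d k)}.

Definition tensor := {ffun mindex -> R}.

Definition tensor_inner (S T : tensor) : R := \sum_(i : mindex) S i * T i.

(* Multi-indices with the k-th index left out: one for each mode-k fibre. *)
Definition mindex_off (k : 'I_m) :=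
  {dffun forall l : {l : 'I_m | l != k}, 'I_(d (val l))}.

Lemma mode_neq (k l : 'I_m) : k <> l -> l != k.
Proof. by move=> kl; apply/eqP => /esym. Qed.

Definition mindex_insert (k : 'I_m) (f : mindex_off k) (j : 'I_(d k)) :
    mindex :=
  [ffun l => match @eqP _ k l with
             | ReflectT e => ecast l 'I_(d l) e j
             | ReflectF ne => f (exist _ l (mode_neq ne))
             end].

Lemma mindex_insert_in (k : 'I_m) (f : mindex_off k) (j : 'I_(d k)) :
  mindex_insert f j k = j.
Proof.
rewrite ffunE; case: eqP => // e.
by rewrite (eq_axiomK e).
Qed.

Lemma mindex_insert_out (k : 'I_m) (f : mindex_off k) (j : 'I_(d k))
    (l : {l : 'I_m | l != k}) :
  mindex_insert f j (val l) = f l.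
Proof.
case: l => l lk /=; rewrite ffunE; case: eqP => [e|ne].
  by case/negP: (lk); rewrite -e.
by congr (f (exist _ l _)); apply: bool_irrelevance.
Qed.

End Tensors.

Section RandomVectors.
Context d0 (Omega : measurableType d0) (R : realType) (P : probability Omega R).

Definition mutually_independent d' (T' : measurableType d') (I : finType)
    (X : I -> {RV P >-> T'}) : Prop :=
  forall (J : {set I}) (B : I -> set T'),
    (forall i, i \in J -> measurable (B i)) ->
    P (\bigcap_(i in [set` J]) X i @^-1` B i) =
    (\prod_(i in J) P (X i @^-1` B i))%E.

Section Component.
Context (n : nat) (Y : {RV P >-> n.-tuple R}) (j : 'I_n).

Definition component : Omega -> R := fun w => tnth (Y w) j.

Lemma measurable_component : measurable_fun [set: Omega] component.
Proof.
by apply: (measurableT_comp (measurable_tnth j)); exact: measurable_funPT.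
Qed.

HB.instance Definition _ := isMeasurableFun.Build _ _ _ _ component
  measurable_component.

End Component.

(* The law N_n(0, I_n). The second parameter of normal_prob is the standard
   deviation. *)
Definition std_normal_vector (n : nat) (Y : {RV P >-> n.-tuple R}) : Prop :=
  mutually_independent (fun j => component Y j : {RV P >-> R}) /\
  forall j (B : set R), measurable B ->
    distribution P (component Y j : {RV P >-> R}) B = normal_prob 0 1 B.

Definition iid_std_normal_vectors (n : nat) (I : finType)
    (Y : I -> {RV P >-> n.-tuple R}) : Prop :=
  mutually_independent Y /\ forall i, std_normal_vector (Y i).

End RandomVectors.

Section RandomTensors.
Context d0 (Omega : measurableType d0) (R : realType) (P : probability Omega R).
Context (m : nat) (d : 'I_m -> nat).

Definition random_tensor := mindex d -> {RV P >-> R}.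

Definition realization (X : random_tensor) (w : Omega) : tensor R d :=
  [ffun i => X i w].

Section Fibre.
Context (X : random_tensor) (k : 'I_m) (f : mindex_off d k).

Definition fibre : Omega -> (d k).-tuple R :=
  fun w => [tuple X (mindex_insert f j) w | j < d k].

Lemma measurable_fibre : measurable_fun [set: Omega] fibre.
Proof.
apply/measurable_fun_tnthP => j.
rewrite (_ : _ \o _ = X (mindex_insert f j)); first exact: measurable_funPT.
by apply/funext => w /=; rewrite tnth_mktuple.
Qed.

HB.instance Definition _ := isMeasurableFun.Build _ _ _ _ fibre
  measurable_fibre.

End Fibre.

Definition std_normal_tensor (X : random_tensor) : Prop :=
  forall k : 'I_m, iid_std_normal_vectors
    (fun f : mindex_off d k => fibre X f : {RV P >-> (d k).-tuple R}).

End RandomTensors.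

Section CharacteristicFunction.
Local Open Scope complex_scope.
Context d0 (Omega : measurableType d0) (R : realType) (P : probability Omega R).

Definition cexp (z : R[i]) : R[i] :=
  (expR (complex.Re z))%:C * (cos (complex.Im z) +i* sin (complex.Im z)).

Definition cexpectation (Z : Omega -> R[i]) : R[i] :=
  fine 'E_P[fun w => complex.Re (Z w)] +i* fine 'E_P[fun w => complex.Im (Z w)].

(* 0 +i* 1 is the imaginary unit; the notation 'i would denote here the
   root of -1 selected by the numClosedFieldType structure of R[i]. *)
Definition char_fun (m : nat) (d : 'I_m -> nat) (X : random_tensor P d)
    (T : tensor R d) : R[i] :=
  cexpectation
    (fun w => cexp ((0 +i* 1) * (tensor_inner T (realization X w))%:C)).

End CharacteristicFunction.

(* Main.v *)
Require Import Defs.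
From HB Require Import structures.
From mathcomp Require Import all_boot all_order all_algebra.
From mathcomp Require Import all_classical all_reals all_analysis.
From mathcomp Require Import complex measurable_realfun.
From mathcomp Require Import ring lra.

Set Implicit Arguments.
Unset Strict Implicit.
Unset Printing Implicit Defensive.

Import Order.TTheory GRing.Theory Num.Theory.
Import numFieldNormedType.Exports.

Local Open Scope ring_scope.
Local Open Scope complex_scope.

(** Let g be the standard Gaussian density. As g'(x) = - x g(x),
    differentiating under the integral sign and integrating by parts show that
    t |-> \int cos (t x + a) g(x) dx solves F' = - t F, so that it equals
    cos a * exp (- t^2 / 2); the phases a = 0 and a = - pi / 2 give the real
    and imaginary parts. The fibres of one single mode partition the entries of
    the tensor, hence the entries are jointly independent standard normal
    variables, and cos (S + t Z + a) =
    cos (S + a) cos (t Z) - cos (S + a - pi / 2) cos (t Z - pi / 2)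
    lets the phased identity be extended to <T, X> one entry at a time. *)

(** * Bounded multipliers of integrable functions *)

Section BoundedFactor.
Context d0 (Y : measurableType d0) (R : realType).

Lemma integrable_norm_le1M (mu : {measure set Y -> \bar R}) (h f : Y -> R) :
  measurable_fun setT h -> (forall y, `|h y| <= 1) ->
  mu.-integrable setT (fun y => (f y)%:E) ->
  mu.-integrable setT (fun y => (h y * f y)%:E).
Proof.
move=> mh h1 intf; apply: (le_integrable _ _ _ intf) => //.
  apply/measurable_EFinP/measurable_funM => //.
  by case/integrableP: intf => /measurable_EFinP.
by move=> y _ /=; rewrite lee_fin normrM ler_piMl.
Qed.

End BoundedFactor.

(** * Phased cosine transform of the standard Gaussian density *)

Section Gaussian.
Local Open Scope classical_set_scope.
Context (R : realType).
Notation mu := (@lebesgue_measure R).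

(** The fundamental theorem of calculus on growing symmetric intervals, then dominated convergence
    with majorant [|k|]. Since [k] is integrable, boundary limits along the integers suffice. *)
Lemma Rintegral_derivative_eq0 (H k : R -> R) :
  (forall x : R, is_derive x 1 H (k x)) -> continuous k ->
  mu.-integrable setT (EFin \o k) ->
  H n%:R @[n --> \oo] --> 0 -> H (- n%:R) @[n --> \oo] --> 0 ->
  (\int[mu]_x k x = 0)%R.
Proof.
move=> dH ck ik H1 H2.
have mk : measurable_fun setT k by exact: continuous_measurable_fun.
(* The successor keeps the endpoints distinct even at [n = 0], as [continuous_FTC2] requires. *)
pose A (n : nat) : set R := `[- n.+1%:R, n.+1%:R].
have mA n : measurable (A n) by exact: measurable_itv.
have [] := @dominated_convergence _ _ _ mu setT measurableT
  (fun n => EFin \o (k \_ (A n))) (EFin \o k) (fun x => (`|k x|)%:E).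
- move=> n; apply/measurable_EFinP/(measurable_restrictT _ (mA n)).
  exact: measurable_funTS.
- exact/measurable_EFinP.
- apply: aeW => x _ /=; apply: cvg_near_cst; near=> n.
  rewrite patchE ifT// inE /A/= in_itv/= -ler_norml.
  have xn : `|x| <= n%:R by near: n; exact: nbhs_infty_ger.
  by rewrite (le_trans xn)// ler_nat.
- by have /integrable_norm := ik.
- apply: aeW => x n _ /=; rewrite lee_fin patchE; case: ifP => //.
  by rewrite normr0.
move=> _ _ dc.
have FTC n : (\int[mu]_x (EFin \o (k \_ (A n))) x =
    (H n.+1%:R - H (- n.+1%:R))%:E)%E.
  rewrite -restrict_EFin -integral_mkcond /A.
  have cH : continuous H.
    by move=> x; apply/differentiable_continuous/derivable1_diffP; case: (dH x).
  rewrite (@continuous_FTC2 _ k H)//.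
  - by rewrite gtrN.
  - exact: continuous_subspaceT.
  - split => [x _||]; first by case: (dH x).
    + exact: cvg_at_right_filter (cH _).
    + exact: cvg_at_left_filter (cH _).
  - by move=> x _; rewrite derive1E; case: (dH x).
have {}dc : (H n.+1%:R - H (- n.+1%:R))%:E @[n --> \oo]
    --> (\int[mu]_x (k x)%:E)%E.
  by under eq_fun do rewrite -FTC; exact: dc.
have lim0 : (H n.+1%:R - H (- n.+1%:R))%:E @[n --> \oo] --> (0 : R)%:E.
  apply/cvg_EFin; first exact: nearW.
  rewrite -(subrr (0 : R)).
  apply: (@cvgB _ R^o).
    by rewrite -(cvg_shiftS (fun n => H n%:R)) in H1.
  by rewrite -(cvg_shiftS (fun n => H (- n%:R))) in H2.
by rewrite /Rintegral (cvg_unique _ dc lim0).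
Unshelve. all: by end_near. Qed.

Notation g := (normal_pdf (0 : R) 1).

Lemma normal_pdf01E x : g x = normal_peak 1 * expR (- (x ^+ 2 / 2)).
Proof.
by rewrite normal_pdfE ?oner_eq0// /normal_fun subr0 expr1n mulNr.
Qed.

Lemma is_derive_normal_pdf01 (x : R) : is_derive x 1 g (- x * g x).
Proof.
rewrite [g](_ : _ = fun x => normal_peak 1 * expR (- (x ^+ 2 / 2))); last first.
  by apply/funext => y; rewrite normal_pdf01E.
apply: trigger_derive; rewrite /GRing.scale/= !mulr1.
set e := expR _; set p := normal_peak _.
by field.
Qed.

Lemma continuous_normal_pdf01 : continuous g.
Proof. exact: continuous_normal_pdf (oner_neq0 R). Qed.

(** A crude decay rate from [1 + y <= expR y] and 1 + n^2/2 >= (n + 1)/2; it makes the boundary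
    terms of the integration by parts vanish. *)
Lemma normal_pdf01_le_harmonic (x : R) (n : nat) : `|x| = n%:R ->
  g x <= normal_peak 1 * 2 * n.+1%:R^-1.
Proof.
move=> xn; rewrite normal_pdf01E -mulrA ler_wpM2l ?normal_peak_ge0//.
rewrite expRN -(invf_div n.+1%:R) lef_pV2 ?posrE ?expR_gt0 ?divr_gt0//.
apply: le_trans (expR_ge1Dx _).
rewrite -real_normK ?num_real// xn -natr1.
by set m : R := n%:R; nra.
Qed.

(** Half of the exponent absorbs [|x|], because |x| <= 4 + x^2 <= 4 exp(x^2/4). The other half is,
    up to normalisation, the Gaussian density of variance 2. *)
Lemma normrM_expR_le (x : R) :
  `|x| * expR (- (x ^+ 2 / 2)) <= 4 * expR (- (x ^+ 2 / 4)).
Proof.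
rewrite (_ : - (x ^+ 2 / 2) = - (x ^+ 2 / 4) - (x ^+ 2 / 4)); last by field.
rewrite expRD mulrA ler_wpM2r ?expR_ge0// expRN ler_pdivrMr ?expR_gt0//.
apply: (@le_trans _ _ (4 * (1 + x ^+ 2 / 4))).
  by rewrite -(real_normK (num_real x)); set z := `|x|; nra.
by rewrite ler_pM2l// expR_ge1Dx.
Qed.

Lemma integrable_id_normal_pdf01 : mu.-integrable setT (fun x => (x * g x)%:E).
Proof.
set p := normal_peak (1 : R); set q := normal_peak (Num.sqrt 2 : R).
have s0 : Num.sqrt 2 != 0 :> R by rewrite sqrtr_eq0 -ltNge.
have p0 : 0 <= p by exact: normal_peak_ge0.
have q0 : q != 0 by rewrite gt_eqF// normal_peak_gt0.
(* The standard deviation sqrt 2 gives the exponent -x^2/4; [p / q] is the ratio of the two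
   normalising constants and 4 comes from [normrM_expR_le]. *)
have le_xg (x : R) : `|x * g x| <= 4 * p / q * normal_pdf 0 (Num.sqrt 2) x.
  rewrite normrM (ger0_norm (normal_pdf_ge0 _ _ _)) normal_pdf01E -/p.
  rewrite normal_pdfE// /normal_fun subr0 sqr_sqrtr// -/q.
  rewrite (_ : - x ^+ 2 / (2 *+ 2) = - (x ^+ 2 / 4)); last by field.
  have := ler_wpM2l p0 (normrM_expR_le x).
  rewrite mulrCA => /le_trans; apply; rewrite le_eqVlt; apply/orP; left.
  by apply/eqP; field.
have := integrable_normal_pdf 0 (Num.sqrt 2 : R).
move=> /(integrableZl measurableT (4 * p / q)).
apply: le_integrable => //.
  apply/measurable_EFinP/measurable_funM => //.
  exact: measurable_normal_pdf.
by move=> x _ /=; rewrite lee_fin (le_trans (le_xg x))// ler_norm.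
Qed.

Lemma measurable_cos_affine (t a : R) :
  measurable_fun setT (fun x => cos (t * x + a)).
Proof.
apply: continuous_measurable_fun => x; apply: differentiable_continuous.
exact/derivable1_diffP.
Qed.

Lemma measurable_sin_affine (t a : R) :
  measurable_fun setT (fun x => sin (t * x + a)).
Proof.
apply: continuous_measurable_fun => x; apply: differentiable_continuous.
exact/derivable1_diffP.
Qed.

Lemma norm_cos_le1 (x : R) : `|cos x| <= 1.
Proof. by rewrite ler_norml cos_geN1 cos_le1. Qed.

Lemma norm_sin_le1 (x : R) : `|sin x| <= 1.
Proof. by rewrite ler_norml sin_geN1 sin_le1. Qed.

Lemma integrable_cosM_normal_pdf01 (a t : R) :
  mu.-integrable setT (fun x => (cos (t * x + a) * g x)%:E).
Proof.
apply: (@integrable_norm_le1M _ _ R mu (fun x => cos (t * x + a))) => [|x|].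
- exact: measurable_cos_affine.
- exact: norm_cos_le1.
- exact: integrable_normal_pdf.
Qed.

(* Integration by parts: the derivative of [sin (t x + a) g(x)] has integral
   zero. *)
Lemma gaussian_stein (a t : R) :
  \int[mu]_x (sin (t * x + a) * (x * g x)) =
  t * \int[mu]_x (cos (t * x + a) * g x).
Proof.
have intc := integrable_cosM_normal_pdf01 a t.
have ints : mu.-integrable setT (fun x => (sin (t * x + a) * (x * g x))%:E).
  apply: (@integrable_norm_le1M _ _ R mu (fun x => sin (t * x + a))) => [|x|].
  - exact: measurable_sin_affine.
  - exact: norm_sin_le1.
  - exact: integrable_id_normal_pdf01.
pose H x := sin (t * x + a) * g x.
pose k x := t * (cos (t * x + a) * g x) - sin (t * x + a) * (x * g x).
have dH (x : R) : is_derive x 1 H (k x).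
  have dg := is_derive_normal_pdf01 x.
  by apply: trigger_derive; rewrite /k /GRing.scale/=; ring.
have intk : mu.-integrable setT (EFin \o k).
  have := integrableB measurableT (integrableZl measurableT t intc) ints.
  exact: eq_integrable.
(* One statement for both boundary sequences, n and -n. *)
have H0 (u : nat -> R) : (forall n, `|u n| = n%:R) ->
    H (u n) @[n --> \oo] --> 0.
  move=> uE; apply: norm_cvg0.
  have lim0 : normal_peak 1 * 2 * @harmonic R n @[n --> \oo] --> 0.
    rewrite -(mulr0 (normal_peak (1 : R) * 2)).
    by apply: cvgM; [exact: cvg_cst|exact: cvg_harmonic].
  apply: (squeeze_cvgr _ (cvg_cst 0) lim0); apply: nearW => n.
  rewrite normr_ge0/= normrM (ger0_norm (normal_pdf_ge0 _ _ _)).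
  apply: le_trans (normal_pdf01_le_harmonic (uE n)).
  by rewrite ler_piMl ?normal_pdf_ge0// norm_sin_le1.
have : \int[mu]_x k x = 0.
  apply: (Rintegral_derivative_eq0 dH) => //.
  - move=> x; have cg := @continuous_normal_pdf01 x.
    have dc : {for x, continuous (fun x : R => cos (t * x + a))}.
      by apply: differentiable_continuous; exact/derivable1_diffP.
    have ds : {for x, continuous (fun x : R => sin (t * x + a))}.
      by apply: differentiable_continuous; exact/derivable1_diffP.
    apply: cvgB; first by apply: cvgM; [exact: cvg_cst|apply: cvgM].
    by apply: cvgM => //; apply: cvgM.
  - by apply: H0 => n; rewrite normr_nat.
  - by apply: H0 => n; rewrite normrN normr_nat.
rewrite /k RintegralB//; last exact: (integrableZl measurableT t intc).
by rewrite RintegralZl// => /eqP; rewrite subr_eq0 => /eqP ->.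
Qed.

Definition gaussian_cos (a t : R) : R := \int[mu]_x (cos (t * x + a) * g x).

(** The derivative of the integrand in the parameter is bounded by [|x * g x|] uniformly in the
    parameter, so differentiation under the integral applies; [gaussian_stein] turns the result back
    into [gaussian_cos]. *)
Lemma is_derive_gaussian_cos (a t : R) :
  is_derive t 1 (gaussian_cos a) (- t * gaussian_cos a t).
Proof.
pose f (t x : R) := cos (t * x + a) * g x.
have d1f (s x : R) : is_derive s 1 (f ^~ x) (- (sin (s * x + a) * (x * g x))).
  by apply: trigger_derive; rewrite /GRing.scale/=; ring.
pose I : set R := `]t - 1, t + 1[.
have tI : I t by rewrite /I/= in_itv/= gtrBl ltrDl ltr01.
have intf (s : R) : I s -> mu.-integrable setT (EFin \o f s).
  by move=> _; exact: integrable_cosM_normal_pdf01.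
have derf (s x : R) : I s -> setT x -> derivable (f ^~ x) s 1.
  by move=> _ _; case: (d1f s x).
have d1fE (s x : R) : partial1of2 f s x = - (sin (s * x + a) * (x * g x)).
  by rewrite partial1of2E; case: (d1f s x).
have ubf (s x : R) : I s -> setT x ->
    `|partial1of2 f s x| <= `|x * g x|.
  by move=> _ _; rewrite d1fE normrN normrM ler_piMl// norm_sin_le1.
have G0 (x : R) : 0 <= `|x * g x| by [].
have intG := integrable_norm integrable_id_normal_pdf01.
have dF := derivable_under_integral measurableT tI intf derf G0 intG ubf.
have := differentiation_under_integral measurableT tI intf derf G0 intG ubf.
rewrite derive1E => DF; apply: DeriveDef; first exact: dF.
rewrite {}DF mulNr -[in RHS]gaussian_stein.
under eq_Rintegral do rewrite /= d1fE.
rewrite -mulN1r -RintegralZl//.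
  by apply: eq_Rintegral => x _; rewrite mulN1r.
apply: (@integrable_norm_le1M _ _ R mu (fun x => sin (t * x + a))) => [|x|].
- exact: measurable_sin_affine.
- exact: norm_sin_le1.
- exact: integrable_id_normal_pdf01.
Qed.

(** The integrating factor exp(t^2/2) turns F' = - t F into a zero derivative; the constant is found
    at t = 0, where [g] has total mass 1. *)
Lemma gaussian_cosE (a t : R) :
  gaussian_cos a t = cos a * expR (- (t ^+ 2 / 2)).
Proof.
pose F (t : R) := gaussian_cos a t * expR (t ^+ 2 / 2).
have dF (s : R) : is_derive s 1 F 0.
  have dg := is_derive_gaussian_cos a s.
  apply: trigger_derive; rewrite /GRing.scale/=.
  by field.
have F0 : F 0 = cos a.
  rewrite /F expr0n/= mul0r expR0 mulr1 /gaussian_cos.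
  under eq_Rintegral do rewrite mul0r add0r.
  rewrite RintegralZl//; last exact: integrable_normal_pdf.
  by rewrite /Rintegral integral_normal_pdf mulr1.
rewrite -F0 -(is_derive_0_is_cst t 0 dF) /F -mulrA -expRD.
by rewrite subrr expR0 mulr1.
Qed.

End Gaussian.

(** * Factorisation of expectations under independence *)

Section Independence.
Import HBSimple.
Local Open Scope classical_set_scope.
Context d0 (Omega : measurableType d0) (R : realType) (P : probability Omega R).

Lemma integrable_norm_le1 (f : Omega -> R) :
  measurable_fun setT f -> (forall w, `|f w| <= 1) ->
  P.-integrable setT (fun w => (f w)%:E).
Proof.
move=> mf f1; have i1 := finite_measure_integrable_cst P 1 measurableT.
have := integrable_norm_le1M mf f1 i1.
by apply: eq_integrable => // w _; rewrite mulr1.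
Qed.

(** Linearity extends the factorisation from indicators to their finite combinations. Integrability
    is proved in the same induction, since additivity of the integral requires it. *)
Lemma Rintegral_factor_sum (U : Omega -> R) (X : {RV P >-> R})
    (B : R -> set R) (s : seq R) :
  measurable_fun setT U -> (forall w, `|U w| <= 1) ->
  (forall y, measurable (B y)) ->
  (forall A, measurable A -> \int[P]_w (U w * \1_A (X w)) =
    \int[P]_w U w * \int[P]_w (\1_A (X w) : R)) ->
  P.-integrable setT (fun w => (\sum_(y <- s) y * \1_(B y) (X w))%:E) /\
  \int[P]_w (U w * \sum_(y <- s) y * \1_(B y) (X w)) =
  \int[P]_w U w * \int[P]_w (\sum_(y <- s) y * \1_(B y) (X w)).
Proof.
move=> mU U1 mB indep.
have mX : measurable_fun setT X by exact: measurable_funPT.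
have i1 y : P.-integrable setT (fun w => (\1_(B y) (X w) : R)%:E).
  apply: integrable_norm_le1 => [|w].
    by apply: measurableT_comp mX; exact: measurable_indic.
  by rewrite indicE; case: (_ \in _); rewrite ?normr1// normr0.
have iU y := integrable_norm_le1M mU U1 (i1 y).
elim: s => [|y s [ints IH]].
  split; first by under eq_fun do rewrite big_nil; exact: integrable0.
  under eq_Rintegral do rewrite big_nil mulr0.
  under [X in _ = _ * X]eq_Rintegral do rewrite big_nil.
  by rewrite Rintegral_cst// mul0r mulr0.
have iy := integrableZl measurableT y (i1 y).
split.
  under eq_fun do rewrite big_cons EFinD EFinM.
  exact: integrableD.
under eq_Rintegral do rewrite big_cons mulrDr mulrCA.
under [X in _ = _ * X]eq_Rintegral do rewrite big_cons.
have iUs := integrable_norm_le1M mU U1 ints.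
have iyU := integrableZl measurableT y (iU y).
rewrite (RintegralD measurableT iyU iUs) (RintegralD measurableT iy ints).
rewrite (RintegralZl _ measurableT (iU y)) (RintegralZl _ measurableT (i1 y)).
by rewrite IH indep// mulrDr mulrCA.
Qed.

(** Simple functions approximate [h] in L1 of the law of [X], and both sides are L1-continuous in
    [h] because [|U| <= 1]. *)
Lemma Rintegral_factor (U : Omega -> R) (X : {RV P >-> R}) (h : R -> R) :
  measurable_fun setT U -> (forall w, `|U w| <= 1) ->
  (forall A, measurable A -> \int[P]_w (U w * \1_A (X w)) =
    \int[P]_w U w * \int[P]_w (\1_A (X w) : R)) ->
  measurable_fun setT h -> (forall x, `|h x| <= 1) ->
  \int[P]_w (U w * h (X w)) = \int[P]_w U w * \int[P]_w h (X w).
Proof.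
move=> mU U1 indep mh h1.
have mX : measurable_fun setT X by exact: measurable_funPT.
have ih : (distribution P X).-integrable setT (EFin \o h).
  apply: (@le_integrable _ _ _ _ _ measurableT _ (cst 1%:E)) => //.
  - exact/measurable_EFinP.
  - by move=> x _ /=; rewrite lee_fin normr1.
  - exact: finite_measure_integrable_cst.
have [G [iG _ Gh]] := approximation_sfun_integrable measurableT ih.
have ihX : P.-integrable setT (fun w => (h (X w))%:E).
  by apply: integrable_norm_le1 => //; exact: measurableT_comp.
have iU : P.-integrable setT (fun w => (U w)%:E) by exact: integrable_norm_le1.
(* The finitely many values of [G n], which is then a combination of the indicators of its level
   sets. *)
pose vals n : seq R := finmap.enum_fset (fset_set (range (G n))).
have GE n x : G n x = \sum_(y <- vals n) y * \1_(G n @^-1` [set y]) x.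
  by rewrite fimfunE fsbig_finite//; exact: fimfunP.
have factG n : P.-integrable setT (fun w => (G n (X w))%:E) /\
   \int[P]_w (U w * G n (X w)) = \int[P]_w U w * \int[P]_w (G n (X w)).
  have mB y : measurable (G n @^-1` [set y]) by exact: measurable_funPTI.
  have [] := Rintegral_factor_sum (vals n) mU U1 mB indep.
  by under eq_fun do rewrite -GE; under eq_Rintegral do rewrite -GE;
    under [X in _ = _ * X]eq_Rintegral do rewrite -GE.
(* The approximation error, moved from the law of [X] to [P] by change of variables. *)
pose eps n := \int[P]_w `|h (X w) - G n (X w)|.
have eps0 : eps n @[n --> \oo] --> 0.
  have GX n : (\int[distribution P X]_z `|(EFin \o h) z - (G n z)%:E|)%E =
      (\int[P]_w (`|h (X w) - G n (X w)|)%:E)%E.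
    rewrite ge0_integral_distribution//.
    apply/measurableT_comp => //; apply/measurable_EFinP/measurable_funB => //.
  have := fine_cvg Gh; under eq_fun do rewrite /= GX; exact.
have iV n : P.-integrable setT (fun w => (h (X w) - G n (X w))%:E).
  by under eq_fun do rewrite EFinB; apply: integrableB => //; case: (factG n).
have iUV n := integrable_norm_le1M mU U1 (iV n).
(* Subtracting the factorisation known for [G n] leaves only terms in [h - G n]. *)
have diffE n : \int[P]_w (U w * h (X w)) - \int[P]_w U w * \int[P]_w h (X w) =
    \int[P]_w (U w * (h (X w) - G n (X w))) -
    \int[P]_w U w * \int[P]_w (h (X w) - G n (X w)).
  have [iGX GXE] := factG n.
  under [X in _ = X - _]eq_Rintegral do rewrite mulrBr.
  rewrite !RintegralB// ?GXE; [ring|exact: integrable_norm_le1M..].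
(* Each of the two error terms is at most [eps n], as [|U| <= 1] and [P] has mass 1. *)
have bnd n : `|\int[P]_w (U w * h (X w)) - \int[P]_w U w * \int[P]_w h (X w)|
    <= eps n *+ 2.
  rewrite (diffE n) mulr2n (le_trans (ler_normB _ _))// lerD//.
    apply: le_trans (le_normr_Rintegral measurableT (iUV n)) _.
    apply: le_Rintegral => //.
    - exact: (integrable_norm (iUV n)).
    - exact: (integrable_norm (iV n)).
    - by move=> w _; rewrite normrM ler_piMl.
  rewrite normrM -[leRHS]mul1r ler_pM//; last first.
    exact: (le_normr_Rintegral measurableT (iV n)).
  apply: le_trans (le_normr_Rintegral measurableT iU) _.
  have <- : \int[P]_w (1 : R) = 1.
    rewrite Rintegral_cst// mul1r; exact: (congr1 fine (probability_setT P)).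
  apply: le_Rintegral => //; first exact: (integrable_norm iU).
  exact: finite_measure_integrable_cst.
apply/eqP; rewrite -subr_eq0 -normr_le0; apply/ler_addgt0Pr => e e0.
have e20 : 0 < e / 2 by rewrite divr_gt0.
have [n _ /(_ n (leqnn n)) epsn] := (cvgr0Pnorm_le _).1 eps0 _ e20.
rewrite add0r (le_trans (bnd n))// -mulr_natr -ler_pdivlMr//.
exact: le_trans (ler_norm _) epsn.
Qed.

End Independence.

(** * Integration against a normal law through its density *)

Section NormalProb.
Local Open Scope classical_set_scope.
Local Open Scope ereal_scope.
Context (R : realType).
Notation mu := (@lebesgue_measure R).

(** After a change of variables by the Radon-Nikodym derivative, that derivative is identified
    almost everywhere with the density: both have the same integral over every measurable set. *)
Lemma integral_normal_prob (m s : R) (f : R -> \bar R) :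
  (normal_prob m s).-integrable setT f ->
  \int[normal_prob m s]_x f x = \int[mu]_x (f x * (normal_pdf m s x)%:E).
Proof.
move=> intf; have mf := measurable_int _ intf.
have dom := normal_prob_dominates m s.
rewrite -(Radon_Nikodym_change_of_variables dom)//=.
apply: ae_eq_integral => //.
- exact: emeasurable_funM.
- apply: emeasurable_funM => //; apply/measurableT_comp => //=.
  exact: measurable_normal_pdf.
apply: ae_eqe_mul2l; rewrite Radon_NikodymE//=.
case: cid => /= h [_ inth hE].
apply: integral_ae_eq => //=.
  by apply: measurableT_comp => //; exact: measurable_normal_pdf.
by move=> E _ mE; rewrite -hE.
Qed.

End NormalProb.

(** * Phased cosine expectation of one standard normal variable *)

Section StdNormal.
Local Open Scope classical_set_scope.
Context d0 (Omega : measurableType d0) (R : realType) (P : probability Omega R).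
Context (Z : {RV P >-> R}).

(* [Real.sort R] and [measurableTypeR R] carry the same sigma-algebra under
   different displays; [normal_prob] is a measure on the latter. *)
Let ZT : Omega -> measurableTypeR R := Z.

Let measurable_ZT : measurable_fun setT ZT.
Proof. exact: (measurable_funPT Z). Qed.

#[local] HB.instance Definition _ :=
  isMeasurableFun.Build _ _ _ _ ZT measurable_ZT.

Lemma Rintegral_cos_std_normal (a t : R) :
  (forall B : set R, measurable B -> distribution P Z B = normal_prob 0 1 B) ->
  \int[P]_w cos (t * Z w + a) = cos a * expR (- (t ^+ 2 / 2)).
Proof.
move=> ZN; pose h (x : measurableTypeR R) := cos (t * x + a).
have mh : measurable_fun setT h := measurable_cos_affine t a.
have h1 x : `|h x| <= 1 by exact: norm_cos_le1.
rewrite -gaussian_cosE /gaussian_cos /Rintegral; congr fine.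
transitivity (\int[distribution P ZT]_x (h x)%:E)%E.
  rewrite integral_distribution//; first exact/measurable_EFinP.
  by apply: integrable_norm_le1 => //; exact: measurableT_comp.
transitivity (\int[normal_prob 0 1]_x (h x)%:E)%E.
  by apply: eq_measure_integral => B mB _; exact: ZN.
by rewrite integral_normal_prob//; apply: integrable_norm_le1.
Qed.

End StdNormal.

(** * Linear combinations of independent standard normal variables *)

Section IndependentStdNormals.
Local Open Scope classical_set_scope.
Context d0 (Omega : measurableType d0) (R : realType) (P : probability Omega R).
Context (I : finType) (Z : I -> {RV P >-> R}).

Definition cylinder (J : {set I}) (B : I -> set R) : set Omega :=
  \bigcap_(i in [set` J]) Z i @^-1` B i.

Lemma measurable_cylinder (J : {set I}) (B : I -> set R) :
  (forall i, measurable (B i)) -> measurable (cylinder J B).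
Proof.
move=> mB; apply: fin_bigcap_measurable => // i _; exact: measurable_funPTI.
Qed.

(** As [i] is not in [J], overriding [B] at [i] leaves the old constraints intact. An extra event on
    [Z i] thus yields again a cylinder, the shape carried by the induction below. *)
Lemma cylinderU1 (J : {set I}) (B : I -> set R) (i : I) (A : set R) :
  i \notin J ->
  cylinder (i |: J)%SET (fun j => if j == i then A else B j) =
  cylinder J B `&` Z i @^-1` A.
Proof.
move=> iJ; apply/seteqP; split=> [w Hw|w [Hw Aw] j /=].
  split=> [j /= jJ|].
    have /= := Hw j; rewrite in_setU1 jJ orbT => /(_ isT).
    by case: eqP jJ iJ => // -> ->.
  by have /= := Hw i; rewrite in_setU1 eqxx; apply.
rewrite in_setU1; case: eqP => [->|_] //= jJ; exact: Hw.
Qed.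

Hypothesis indepZ : mutually_independent Z.
Hypothesis stdZ : forall i (B : set R), measurable B ->
  distribution P (Z i) B = normal_prob 0 1 B.

Lemma prob_cylinderI (J : {set I}) (B : I -> set R) (i : I) (A : set R) :
  (forall j, measurable (B j)) -> measurable A -> i \notin J ->
  P (cylinder J B `&` Z i @^-1` A) = (P (cylinder J B) * P (Z i @^-1` A))%E.
Proof.
move=> mB mA iJ; rewrite -cylinderU1// /cylinder indepZ; last first.
  by move=> j _; case: ifP.
rewrite big_setU1//= eqxx muleC indepZ//; congr (_ * _)%E.
by apply: eq_bigr => j jJ; case: eqP jJ iJ => // -> ->.
Qed.

(* The indicator of an event on the variables outside [s] keeps track, along
   the induction on [s], of the independence of the remaining variables. *)
Lemma Rintegral_cos_sum_std_normal (t : I -> R) (s : seq I) (J : {set I})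
    (B : I -> set R) (a : R) :
  uniq s -> {in s, forall i, i \notin J} -> (forall i, measurable (B i)) ->
  \int[P]_w (cos (\sum_(i <- s) t i * Z i w + a) * \1_(cylinder J B) w) =
  cos a * expR (- ((\sum_(i <- s) t i ^+ 2) / 2)) * fine (P (cylinder J B)).
Proof.
move=> + + mB; elim: s J B mB a => [|i s IH] J B mB a.
  move=> _ _; have mC := measurable_cylinder J mB.
  under eq_Rintegral do rewrite big_nil add0r.
  rewrite RintegralZl//; last exact: integrable_indic.
  rewrite big_nil mul0r oppr0 expR0 mulr1.
  by rewrite /Rintegral integral_indic// setIT.
rewrite cons_uniq => /andP[is_ us] sJ.
have iJ : i \notin J by apply: sJ; rewrite mem_head.
have sJ' : {in s, forall j, j \notin J}.
  by move=> j js; apply: sJ; rewrite inE js orbT.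
have mC := measurable_cylinder J mB.
(* The phase [b] stays free: both [a] and [a - pi / 2] occur below. *)
pose U b w := cos (\sum_(j <- s) t j * Z j w + b) * \1_(cylinder J B) w.
have mU b : measurable_fun setT (U b).
  apply: measurable_funM; last exact: measurable_indic.
  have mcos : measurable_fun setT (@cos R).
    by apply: continuous_measurable_fun; exact: continuous_cos.
  apply: measurableT_comp mcos _.
  apply: measurable_funD => //; apply: measurable_sum => j.
  by apply: measurable_funM => //; exact: measurable_funPT.
have U1 b w : `|U b w| <= 1.
  rewrite normrM -[leRHS]mul1r ler_pM ?norm_cos_le1// indicE.
  by case: (_ \in _); rewrite ?normr1 ?normr0.
(* The event on [Z i] merges into the cylinder, so the induction hypothesis evaluates both sides,
   once with [i |: J] and once with [J]. *)
have indU b (A : set R) : measurable A ->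
    \int[P]_w (U b w * \1_A (Z i w)) =
    \int[P]_w U b w * \int[P]_w (\1_A (Z i w) : R).
  move=> mA; pose B' j := if j == i then A else B j.
  have mB' j : measurable (B' j) by rewrite /B'; case: ifP.
  have sJi : {in s, forall j, j \notin (i |: J)%SET}.
    move=> j js; rewrite in_setU1 negb_or sJ'// andbT.
    by apply: contraNneq is_ => <-.
  transitivity (\int[P]_w (cos (\sum_(j <- s) t j * Z j w + b) *
      \1_(cylinder (i |: J)%SET B') w)).
    apply: eq_Rintegral => w _.
    by rewrite cylinderU1// indicI /U mulrA; congr (_ * _).
  rewrite /U IH//; rewrite IH// cylinderU1// prob_cylinderI//.
  rewrite fineM ?fin_num_measure//.
    rewrite mulrA; congr (_ * _).
    rewrite [in RHS]/Rintegral.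
    rewrite (_ : (fun w => _) = EFin \o (\1_(Z i @^-1` A) : _ -> R))//.
    by rewrite integral_indic ?setIT//; exact: measurable_funPTI.
  exact: measurable_funPTI.
have fact b u v := Rintegral_factor (mU b) (U1 b) (indU b)
  (measurable_cos_affine u v) (fun x => norm_cos_le1 _).
have integrable_Ucos b v :
    P.-integrable setT (EFin \o (fun w => U b w * cos (t i * Z i w + v))).
  apply: (integrable_norm_le1M (mU b) (U1 b)).
  apply: integrable_norm_le1 => [|w]; last exact: norm_cos_le1.
  apply: measurableT_comp (measurable_cos_affine _ _) _.
  exact: measurable_funPT.
(* Sines are written as shifted cosines, so that the induction involves cosines only. *)
have cosBpihalf x : cos (x - pi / 2) = sin x :> R.
  by rewrite cosB cos_pihalf sin_pihalf mulr0 mulr1 add0r.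
transitivity (\int[P]_w (U a w * cos (t i * Z i w + 0)) -
    \int[P]_w (U (a - pi / 2) w * cos (t i * Z i w + (- (pi / 2))))).
  rewrite -RintegralB//; apply: eq_Rintegral => w _.
  rewrite /U big_cons addr0 (addrA _ a) !cosBpihalf -(addrA (t i * _)) cosD.
  ring.
(* The second product vanishes because cos(- pi/2) = 0; the first contributes the factor exp(-
   t_i^2/2). *)
rewrite !fact !(Rintegral_cos_std_normal _ _ (@stdZ i)) /U !IH//.
rewrite cos0 cosN cos_pihalf !mul0r mulr0 subr0 mul1r big_cons.
by rewrite mulrDl opprD expRD; ring.
Qed.

End IndependentStdNormals.

(** * Joint independence of the tensor entries *)

Section Entries.
Local Open Scope classical_set_scope.

Section Index.
Context (m : nat) (d : 'I_m -> nat) (k : 'I_m).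

(** Together with the coordinate [i k], this inverts [mindex_insert]: a multi-index amounts to a
    mode-[k] fibre and a position in it. *)
Definition mindex_restrict (i : mindex d) : mindex_off d k :=
  [ffun l => i (val l)].

Lemma mindex_restrictK (i : mindex d) :
  mindex_insert (mindex_restrict i) (i k) = i.
Proof.
apply/ffunP => l; have [->|lk] := eqVneq l k; first exact: mindex_insert_in.
by rewrite (mindex_insert_out _ _ (exist _ l lk)) ffunE.
Qed.

Lemma mindex_insertK (f : mindex_off d k) (j : 'I_(d k)) :
  mindex_restrict (mindex_insert f j) = f.
Proof. by apply/ffunP => l; rewrite ffunE mindex_insert_out. Qed.

End Index.

Context d0 (Omega : measurableType d0) (R : realType) (P : probability Omega R).
Context (m : nat) (d : 'I_m -> nat) (k : 'I_m) (X : random_tensor P d).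

Lemma component_fibre (f : mindex_off d k) (j : 'I_(d k)) :
  component (fibre X f : {RV P >-> (d k).-tuple R}) j = X (mindex_insert f j).
Proof. by apply/funext => w; rewrite /component tnth_mktuple. Qed.

Hypothesis iidX : iid_std_normal_vectors
  (fun f : mindex_off d k => fibre X f : {RV P >-> (d k).-tuple R}).

Lemma std_normal_entry (i : mindex d) (B : set R) : measurable B ->
  distribution P (X i) B = normal_prob 0 1 B.
Proof.
move=> mB; have [_ /(_ (mindex_restrict k i)) [_ /(_ (i k) B mB)]] := iidX.
by rewrite /distribution/= component_fibre mindex_restrictK.
Qed.

(** An event on entries is an intersection of events on whole fibres. Independence between fibres
    gives a product over fibres, and independence within each fibre splits every factor further. *)
Lemma mutually_independent_entries : mutually_independent X.
Proof.
(* Indices outside [J] get the trivial constraint, so that every fibre is constrained at all its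
   positions. *)
move=> J B mB; pose B' i := if i \in J then B i else setT.
have mB' i : measurable (B' i) by rewrite /B'; case: ifPn => // /mB.
pose C (f : mindex_off d k) : set ((d k).-tuple R) :=
  \bigcap_(j in [set` [set: 'I_(d k)]%SET])
    (fun y => tnth y j) @^-1` B' (mindex_insert f j).
have mC f : measurable (C f).
  apply: fin_bigcap_measurable => // j _.
  rewrite -[X in measurable X]setTI.
  exact: (measurable_tnth j).
have [indf stdf] := iidX.
have PC f : P (fibre X f @^-1` C f) =
    (\prod_(j < d k) P (X (mindex_insert f j) @^-1` B' (mindex_insert f j)))%E.
  have [indc _] := stdf f.
  have := indc [set: _]%SET (fun j => B' (mindex_insert f j))
    (fun j _ => mB' _).
  under eq_bigcapr do rewrite /= component_fibre.
  under eq_bigr do rewrite /= component_fibre.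
  rewrite (eq_bigl xpredT) => [<-|j]; last by rewrite finset.in_setT.
  congr (P _); rewrite /C preimage_bigcap; apply: eq_bigcapr => j _.
  by apply/seteqP; split => w /=; rewrite tnth_mktuple.
have -> : \bigcap_(i in [set` J]) X i @^-1` B i =
    \bigcap_(f in [set` [set: mindex_off d k]%SET]) fibre X f @^-1` C f.
  apply/seteqP; split=> [w Hw f _ j _ /=|w Hw i /= iJ].
    rewrite tnth_mktuple /B'; case: ifP => // iJ; exact: Hw.
  have /= := Hw (mindex_restrict k i).
  rewrite finset.in_setT => /(_ isT (i k)) /=.
  by rewrite finset.in_setT tnth_mktuple mindex_restrictK /B' iJ; apply.
rewrite (indf [set: _]%SET C (fun f _ => mC f)).
under eq_bigr do rewrite PC.
rewrite (eq_bigl xpredT); last by move=> f; rewrite finset.in_setT.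
rewrite pair_big/= [RHS]big_mkcond/=.
(* This bijection flattens the double product; the factors outside [J] are probabilities of the full
   space, equal to 1. *)
pose ins (p : mindex_off d k * 'I_(d k)) := mindex_insert p.1 p.2.
rewrite [RHS](reindex ins)/=.
  apply: eq_bigr => -[f j] _ /=; rewrite /B' /ins/=; case: ifP => // _.
  by rewrite preimage_setT probability_setT.
exists (fun i => (mindex_restrict k i, i k)) => [[f j] _|i _] /=.
  by rewrite mindex_insertK mindex_insert_in.
exact: mindex_restrictK.
Qed.

End Entries.

(** * Real and imaginary parts of the characteristic function *)

Theorem theorem4p8 (R : realType) (d0 : measure_display)
    (Omega : measurableType d0) (P : probability Omega R)
    (m : nat) (hm : (0 < m)%N) (d : 'I_m -> nat) (hd : forall k, (0 < d k)%N)
    (X : random_tensor P d) (hX : std_normal_tensor X) (T : tensor R d) :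
  char_fun X T = (expR (- (1 / 2) * tensor_inner T T))%:C.
Proof.
(* The first mode is used; it exists because [0 < m]. *)
have iidX := hX (Ordinal hm).
set q : R := expR _.
have E (a : R) :
    (\int[P]_w cos (tensor_inner T (realization X w) + a) = cos a * q)%R.
  (* With [J] empty the cylinder is the whole space, so its indicator and its probability are 1. *)
  have J0 : {in index_enum (mindex d),
      forall i, i \notin (finset.set0 : {set mindex d})}.
    by move=> i _; rewrite finset.in_set0.
  have := Rintegral_cos_sum_std_normal (mutually_independent_entries iidX)
    (std_normal_entry iidX) T a (index_enum_uniq _) J0 (fun _ => measurableT).
  rewrite (_ : cylinder _ _ _ = setT)%classic; last first.
    by apply/seteqP; split => // w _ i /=; rewrite finset.in_set0.
  rewrite (congr1 fine (probability_setT P)) mulr1.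
  rewrite (_ : - _ = - (1 / 2) * tensor_inner T T)%R; last first.
    by rewrite mulNr mul1r mulrC; congr (- (_ * _))%R.
  move=> <-; apply: eq_Rintegral => w _; rewrite indicT mulr1.
  congr (cos (_ + _))%R.
  by apply: eq_bigr => i _; rewrite ffunE.
have cE : (\int[P]_w cos (tensor_inner T (realization X w)) = q)%R.
  by rewrite -[RHS]mul1r -cos0 -E; apply: eq_Rintegral => w _; rewrite addr0.
(* The phase [- (pi / 2)] turns the cosine into the sine, and cos(- pi/2) = 0. *)
have sE : (\int[P]_w sin (tensor_inner T (realization X w)) = 0)%R.
  have <- : (cos (- (pi / 2)) * q = 0)%R by rewrite cosN cos_pihalf mul0r.
  rewrite -E; apply: eq_Rintegral => w _.
  by rewrite cosB cos_pihalf sin_pihalf mulr0 mulr1 add0r.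
rewrite /char_fun /cexpectation !unlock.
have cexpE (x : R) : cexp ((0 +i* 1) * x%:C) = cos x +i* sin x.
  rewrite /cexp /= !mul0r !mul1r !add0r oppr0 expR0.
  by rewrite mul1r.
under eq_integral do rewrite cexpE /=.
under [X in _ +i* fine X]eq_integral do rewrite cexpE /=.
by congr (_ +i* _); [exact: cE|exact: sE].
Qed.
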